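(* Let $\lambda$ be a cardinal and let $\{\gamma_\xi\colon\xi<\lambda\}$ be an indexed family of non-zero ordinals, each regarded as a topological space with the order topology. Then the $\sigma$-product $\sigma\left(\prod_{\xi<\lambda}\gamma_\xi,\mathbf{0}\right)$ is exponentially separable.
   Context: An ordinal is identified with the set of smaller ordinals and given the order topology. $\mathbf{0}$ denotes the element of $\prod_{\xi<\lambda}\gamma_\xi$ with constant value $0$. For $x\in\prod_{\xi<\lambda}\gamma_\xi$ let $\mathrm{supp}_{\mathbf{0}}(x)=\{\xi<\lambda\colon x(\xi)\neq 0\}$. The $\sigma$-product is $\sigma\left(\prod_{\xi<\lambda}\gamma_\xi,\mathbf{0}\right)=\{x\in\prod_{\xi<\lambda}\gamma_\xi\colon \mathrm{supp}_{\mathbf{0}}(x)\text{ is finite}\}$, with the subspace topology inherited from the product topology. Given a topological space $X$ and a family $\mathcal{F}$ of subsets of $X$, a set $A\subset X$ is strongly dense in $\mathcal{F}$ if $A\cap\left(\bigcap\mathcal{G}\right)\neq\emptyset$ whenever $\mathcal{G}\subset\mathcal{F}$ and $\bigcap\mathcal{G}\neq\emptyset$. The space $X$ is exponentially separable if for every countable family $\mathcal{F}$ of closed subsets of $X$ there is a countable subset $A$ of $X$ that is strongly dense in $\mathcal{F}$. *)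

(* Defs.v *)
From HB Require Import structures.
From mathcomp Require Import all_boot all_order.
From mathcomp Require Import boolp classical_sets functions cardinality wochoice.
From mathcomp Require Import topology.

Set Implicit Arguments.
Unset Strict Implicit.
Unset Printing Implicit Defensive.

Local Open Scope classical_set_scope.
Local Open Scope order_scope.

(* An ordinal is represented by a well-ordered type: its elements are the
   smaller ordinals, and the initial segment below an element is that smaller
   ordinal.  A non-zero ordinal is a well-ordered [bOrderType], whose [\bot]
   is the ordinal 0. *)
Definition is_ordinal d (T : orderType d) : Prop :=
  well_order (<=%O : rel T).

(* A cardinal is an ordinal equipotent to no smaller ordinal. *)
Definition is_cardinal d (T : orderType d) : Prop :=
  is_ordinal T /\
  forall x : T, ~ ([set: T] #= [set y : T | y < x])%card.

Section SigmaProduct.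
Context {I : Type} {d : I -> Order.disp_t}.
Variable gamma : forall xi : I, bOrderType (d xi).

Definition factor_space (xi : I) : topologicalType := order_topology (gamma xi).

Definition full_product : topologicalType := prod_topology factor_space.

Definition supp0 (x : full_product) : set I :=
  [set xi | (x xi : gamma xi) <> \bot].

Definition sigma_set : set full_product :=
  [set x | finite_set (supp0 x)].

(* The coercion from sets to types is [set_type], whose topology is the
   subspace topology; the library's [subspace] would instead retopologize the
   whole product. *)
Definition sigma_product : topologicalType := (sigma_set : Type).

End SigmaProduct.

(* The intersection of the empty family is the whole space, as for [\bigcap]. *)
Definition strongly_dense_in (X : Type) (F : set (set X)) (A : set X) : Prop :=
  forall G : set (set X), G `<=` F ->
    (\bigcap_(B in G) B) !=set0 ->
    (A `&` \bigcap_(B in G) B) !=set0.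

Definition exponentially_separable (X : topologicalType) : Prop :=
  forall F : set (set X), countable F -> F `<=` closed ->
    exists A : set X, countable A /\ strongly_dense_in F A.

(* Main.v *)
Require Import Defs.
From HB Require Import structures.
From mathcomp Require Import all_boot all_order.
From mathcomp Require Import boolp classical_sets functions cardinality wochoice.
From mathcomp Require Import interval set_interval filter topology.

(** The proof is a Loewenheim-Skolem argument carried out with coordinate
    values, that is, with pairs [(xi, p)] where [p < gamma_xi].

    Let FF be a countable family of closed sets.  Closing off under witnesses
    gives a countable set M of coordinate values that reflects FF
    ([reflecting_set]): for every F in FF, every x in F and every finite
    [S `<=` M], some x' in F takes its non-zero values in M and lies on the
    same side as x of every value recorded in S.

    Replace each coordinate of a point x by the supremum of the values of M
    not exceeding it.  The resulting point is [trace M x].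

    The trace stays in every F of FF that contains x ([closed_trace]).  The
    points x' given by reflection, for S growing, converge to the trace at
    each coordinate: the values of M below [x xi] push [x' xi] up towards
    their supremum, while [x' xi] cannot exceed that supremum once S contains
    the first value of M above [x xi].  As the x' have their non-zero values
    in M, this also makes them vanish at the coordinates where M has no
    value.  Now F is closed, so it contains the limit.

    There are only countably many traces.  A supremum of an initial segment
    of a well-ordered fibre of M is determined by the first element of the
    fibre beyond that segment, or by the fibre itself if there is none
    ([countable_trace_values]); and the trace has finite support, because it
    lies below x.  A trace is thus encoded by a finite subset of a countable
    set.

    So the set of all traces is a countable set strongly dense in FF: if x
    lies in every member of a subfamily, then so does its trace. *)

Set Implicit Arguments.
Unset Strict Implicit.
Unset Printing Implicit Defensive.

Import Order.TTheory.
Local Open Scope order_scope.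
Local Open Scope classical_set_scope.

(** * Countable closure *)

Lemma countable_setU (Y : Type) (A B : set Y) :
  countable A -> countable B -> countable (A `|` B).
Proof.
by move=> cA cB; rewrite -bigcup2E; apply: bigcup_countable => // -[|[|i]].
Qed.

(** Iterating [Phi] over finite subsets [omega] times suffices, because a finite
    subset of the union of an increasing sequence lies in one of its terms. *)
Lemma countable_closure (Y : Type) (Phi : set Y -> set Y) :
  (forall S, finite_set S -> countable (Phi S)) ->
  exists2 M : set Y, countable M &
    forall S, finite_set S -> S `<=` M -> Phi S `<=` M.
Proof.
move=> cPhi.
pose step N := N `|` \bigcup_(S in [set S | S `<=` N /\ finite_set S]) Phi S.
pose stage n := iter n step set0.
have stage_count n : countable (stage n).
  elim: n => [|n IH]; first exact: countable0.
  apply: countable_setU => //; apply: bigcup_countable.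
    exact: countable_finite_subset.
  by move=> S [_ /cPhi].
have stage_le m n : (m <= n)%N -> stage m `<=` stage n.
  move=> /subnK <-; elim: (n - m)%N => // k IH y /IH ?.
  by rewrite addSn; left.
exists (\bigcup_n stage n); first by apply: bigcup_countable.
move=> S Sfin SM.
have [n Sn] : exists n, S `<=` stage n.
  have /(_ _)/cid -/all_sig [h hP] (y : S) : exists n, stage n (val y).
    have [|n _ ?] := SM (val y); first exact: set_valP.
    by exists n.
  have [N NP] : exists N, forall y : S, (h y <= N)%N.
    have /finite_fsetP[X XE] : finite_set (range h).
      by apply: finite_image; rewrite (eq_finite_set (card_setT S)).
    exists (\max_(i <- finmap.enum_fset X) i)%N => y.
    apply: leq_bigmax_seq => //.
    have : range h (h y) by exists y.
    by rewrite XE.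
  exists N => y Sy; apply: (stage_le _ _ (NP (SigSub (mem_set Sy)))).
  exact: hP.
by move=> y Py; exists n.+1 => //; right; exists S.
Qed.

(** * Minima and suprema in ordinals *)

Section Ordinal.
Context {d : Order.disp_t} {T : bOrderType d}.
Hypothesis T_ord : is_ordinal T.

Lemma ordinal_min (B : set T) :
  B !=set0 -> exists2 m, B m & lbound B m.
Proof.
case=> b Bb; have [|m [[Bm mP] _]] := T_ord (A := mem B).
  by exists b; rewrite inE.
exists m; first by rewrite inE in Bm.
by move=> y By; apply: mP; rewrite inE.
Qed.

(** The supremum exists as soon as there is an upper bound; for the empty set
    it is 0, which is also the default value of [supremum \bot]. *)
Lemma ordinal_supremum (B : set T) :
  ubound B !=set0 ->
  ubound B (supremum \bot B) /\ lbound (ubound B) (supremum \bot B).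
Proof.
move=> /ordinal_min [m um lm]; rewrite /supremum; case: ifPn => [/eqP ->|_].
  by split=> // y _; exact: le0x.
by case: xgetP => [x -> //|/(_ m)]; case.
Qed.

End Ordinal.

(** * Reflection and traces *)

Section Trace.
Context {I : Type} {d : I -> Order.disp_t}.
Variable gamma : forall xi : I, bOrderType (d xi).
Hypothesis gamma_ord : forall xi, is_ordinal (gamma xi).

Definition coord_value : Type := {xi : I & gamma xi}.

(** For finite S, the set [S `&` below x] is the type of x over S: it records
    on which side of each value in S the point x lies. *)
Definition below (x : forall xi, gamma xi) : set coord_value :=
  [set y | projT2 y <= x (projT1 y)].

(** The graph of x over its support. It determines x, and it is finite exactly
    when x belongs to the sigma-product. *)
Definition support_graph (x : forall xi, gamma xi) : set coord_value :=
  [set y | projT2 y = x (projT1 y) /\ x (projT1 y) <> \bot].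

Lemma support_graph_finite (x : forall xi, gamma xi) :
  finite_set [set xi | x xi <> \bot] -> finite_set (support_graph x).
Proof.
move=> /(finite_image (fun xi => existT gamma xi (x xi) : coord_value)).
apply: sub_finite_set => -[xi v] [/= -> xN].
by exists xi.
Qed.

Lemma support_graph_inj : injective support_graph.
Proof.
suff sub x x' : support_graph x = support_graph x' ->
    forall xi, x xi <> \bot -> x xi = x' xi.
  move=> x x' E; apply: functional_extensionality_dep => xi.
  have [x0|/(sub _ _ E)//] := pselect (x xi = \bot).
  have [x0'|/(sub _ _ (esym E))//] := pselect (x' xi = \bot).
  by rewrite x0 x0'.
move=> E xi xN; have : support_graph x (existT _ xi (x xi)) by [].
by rewrite E => -[].
Qed.

(** Over a finite set S there are finitely many types, hence countably many
    pairs of a member F of [FF] and a type over S.  Choosing one point of F for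
    each realized pair and adding its finitely many non-zero values is a
    closure operation to which [countable_closure] applies. *)
Lemma reflecting_set (FF : set (set (forall xi, gamma xi))) :
  countable FF ->
  (forall F x, FF F -> F x -> finite_set (support_graph x)) ->
  exists2 M : set coord_value, countable M &
    forall F x S, FF F -> F x -> finite_set S -> S `<=` M ->
      exists x', [/\ F x', support_graph x' `<=` M &
                     S `&` below x' = S `&` below x].
Proof.
move=> FFc Ffin.
pose cut F S t x := F x /\ S `&` below x = t.
pose w F S t := xget (fun=> \bot) (cut F S t).
(* When F has no point of type t over S, the condition [F (w F S t)] discards
   the default value of [xget], unless that value itself belongs to F. *)
pose Phi S := \bigcup_(F in FF)
  \bigcup_(t in [set t | t `<=` S /\ finite_set t])
  [set y | support_graph (w F S t) y /\ F (w F S t)].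
have [S Sfin|M Mc MP] := @countable_closure _ Phi.
  apply: bigcup_countable => // F FFF; apply: bigcup_countable.
    exact/countable_finite_subset/finite_set_countable.
  move=> t _; have [Fw|nFw] := pselect (F (w F S t)).
    apply: finite_set_countable; apply: sub_finite_set (Ffin _ _ FFF Fw).
    by move=> y [].
  by rewrite [X in countable X](_ : _ = set0) // -subset0 => y [].
exists M => // F x S FFF Fx Sfin SM.
have [wF wS] : cut F S (S `&` below x) (w F S (S `&` below x)).
  by rewrite /w; case: xgetP => [x' -> //|/(_ x)]; case.
exists (w F S (S `&` below x)); split=> // y Gy.
apply: (MP S) => //; exists F => //; exists (S `&` below x); last by [].
by split; [exact: subIsetl|exact: finite_setIl].
Qed.

Definition trace (M : set coord_value) (x : forall xi, gamma xi) :
    forall xi, gamma xi :=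
  fun xi => supremum \bot [set p | M (existT _ xi p) /\ p <= x xi].

Lemma trace_supremum M x xi :
  let B := [set p | M (existT _ xi p) /\ p <= x xi] in
  ubound B (trace M x xi) /\ lbound (ubound B) (trace M x xi).
Proof.
by apply: ordinal_supremum => //; exists (x xi) => p [].
Qed.

Lemma trace_le M x xi : trace M x xi <= x xi.
Proof. by have [_] := trace_supremum M x xi; apply => p []. Qed.

Lemma trace_support M x :
  [set xi | trace M x xi <> \bot] `<=` [set xi | x xi <> \bot].
Proof.
move=> xi /= tN x0; apply: tN; apply/le_anti.
by rewrite le0x -[X in _ <= X]x0 trace_le.
Qed.

(** The set of p in the fibre of M over xi with [p <= x xi] is an initial
    segment of that fibre.  Either it is the whole fibre, or it is the set of
    p below the first q in the fibre with [x xi < q]; so its supremum is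
    determined by xi or by the pair [(xi, q)].  A non-zero supremum comes from
    a non-empty fibre, hence only countably many xi occur. *)
Lemma countable_trace_values (M : set coord_value) :
  countable M ->
  exists2 V : set coord_value, countable V &
    forall x, support_graph (trace M x) `<=` V.
Proof.
move=> Mc.
pose fiber xi := [set p | M (existT gamma xi p)].
pose lower (y : coord_value) : coord_value :=
  existT gamma (projT1 y)
    (supremum \bot [set p | fiber (projT1 y) p /\ p < projT2 y]).
pose whole (y : coord_value) : coord_value :=
  existT gamma (projT1 y) (supremum \bot (fiber (projT1 y))).
exists (lower @` M `|` whole @` M).
  by apply: countable_setU; apply: (sub_countable (card_image_le _ _)) Mc.
move=> x [xi v] [/= -> ]; rewrite /trace.
set B := [set p | _] => BN.
have [p [Mp _]] : B !=set0.
  by apply/set0P/eqP => B0; apply: BN; rewrite B0 /supremum eqxx.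
have [/(ordinal_min (@gamma_ord xi)) [q [Mq xq] qmin]|Q0] :=
  pselect ([set q | fiber xi q /\ x xi < q] !=set0); last first.
  suff -> : B = fiber xi by right; exists (existT _ xi p).
  apply/seteqP; split=> [r []|r Mr] //; split=> //.
  by rewrite leNgt; apply/negP => xr; apply: Q0; exists r.
suff -> : B = [set p | fiber xi p /\ p < q] by left; exists (existT _ xi q).
apply/seteqP; split=> r [Mr] /= rq; split=> //; first exact: le_lt_trans xq.
by rewrite leNgt; apply/negP => xr; move: rq; rewrite ltNge qmin.
Qed.

End Trace.

(** * Convergence to traces *)

Lemma cvg_initial (S : choiceType) (T : topologicalType) (f : S -> T)
    (G : set_system S) (s : S) :
  Filter G -> f x @[x --> G] --> f s -> G --> (s : initial_topology f).
Proof.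
move=> FG fG A /= [_ [[B Bop <-] Bfs BA]].
by rewrite nbhs_filterE; apply: filterS BA _; apply: fG; exact: open_nbhs_nbhs.
Qed.

Lemma cvg_order_rays d (T : orderType d) (X : Type) (G : set_system X)
    (f : X -> T) (z : T) :
  Filter G ->
  (forall a, a < z -> G [set x | a < f x]) ->
  (forall b, z < b -> G [set x | f x < b]) ->
  (f : X -> order_topology T) x @[x --> G] --> (z : order_topology T).
Proof.
move=> FG lo hi U; rewrite /= order_nbhs_itv => -[i [iop zi] iU].
rewrite nbhs_filterE; apply: filterS iU _; rewrite /nbhs /=.
case: i iop zi => [[[]a|[]]] [[]b|[]] //= _; rewrite in_itv /= => zi.
- have [za zb] := andP zi.
  apply: filterS (filterI (lo _ za) (hi _ zb)) => x [? ?].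
  by rewrite /= in_itv; apply/andP.
- rewrite andbT in zi; apply: filterS (lo _ zi) => x.
  by rewrite /= in_itv /= andbT.
- by apply: filterS (hi b _) => [x|//]; rewrite /= in_itv.
- by apply: filterE => x; rewrite /= in_itv.
Qed.

Section SigmaProduct.
Context {I : Type} {d : I -> Order.disp_t}.
Variable gamma : forall xi : I, bOrderType (d xi).
Hypothesis gamma_ord : forall xi, is_ordinal (gamma xi).

(** The inclusion into the product, typed so that the order on each [gamma xi]
    is visible rather than only its topology. *)
Definition coords (x : sigma_product gamma) : forall xi, gamma xi := set_val x.

(** The points of F that reflect x over finite subsets of M generate a filter
    base indexed by these finite subsets; it converges to the trace of x, at
    each coordinate from below. *)
Lemma closed_trace (F : set (sigma_product gamma)) (M : set (coord_value gamma))
    (x z : sigma_product gamma) :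
  closed F ->
  (forall S, finite_set S -> S `<=` M ->
     exists x', [/\ F x', support_graph (coords x') `<=` M &
                    S `&` below (coords x') = S `&` below (coords x)]) ->
  coords z = trace M (coords x) -> F z.
Proof.
move=> Fcl MP zE.
pose B S := [set x' | [/\ F x', support_graph (coords x') `<=` M &
                    S `&` below (coords x') = S `&` below (coords x)]].
pose D := [set S : set (coord_value gamma) | finite_set S /\ S `<=` M].
pose G := filter_from D B.
have FG : Filter G.
  apply: filter_from_filter => [|S S' [Sf SM] [S'f S'M]].
    by exists set0; split.
  exists (S `|` S') => [|x' [Fx' x'M E]].
    by split; [rewrite finite_setU|rewrite subUset].
  have E' R : R `<=` S `|` S' ->
      R `&` below (coords x') = R `&` below (coords x).
    by move=> /setIidl <-; rewrite -!setIA E.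
  by split; split=> //; apply: E'; [exact: subsetUl|exact: subsetUr].
have PG : ProperFilter G by apply: filter_from_proper => S [Sf SM]; exact: MP.
have Gz : G --> z; last first.
  apply: Fcl => U /Gz; rewrite nbhs_filterE => GU.
  have GF : G F by exists set0 => [|x' []]; first by split.
  exact: filter_ex (filterI GF GU).
apply: cvg_initial; apply/cvg_sup => xi; apply: cvg_initial.
have [tub tlub] := trace_supremum gamma_ord M (coords x) xi.
have zxi : (set_val z : full_product gamma) xi = trace M (coords x) xi.
  by rewrite -zE.
(* If [x' xi] is non-zero, it belongs to M, so it is at most the trace as soon
   as it is at most [x xi]; the first value q of M above [x xi] forces this. *)
have upper : G [set x' | coords x' xi <= trace M (coords x) xi].
  have [/(ordinal_min (@gamma_ord xi)) [q [Mq xq] qmin]|Q0] :=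
    pselect ([set q | M (existT _ xi q) /\ coords x xi < q] !=set0).
    exists [set existT _ xi q] => [|x' [_ x'M x'E] /=].
      by split => [|_ ->]; [exact: finite_set1|].
    have [->|x'N] := pselect (coords x' xi = \bot); first exact: le0x.
    have Mx' : M (existT _ xi (coords x' xi)) by apply: x'M.
    apply: tub; split=> //; rewrite leNgt; apply/negP => /= xx'.
    have qx' : q <= coords x' xi by apply: qmin.
    have : ([set existT _ xi q] `&` below (coords x')) (existT _ xi q) by [].
    by rewrite x'E => -[_]; rewrite /below /= leNgt xq.
  exists set0 => [|x' [_ x'M _] /=]; first by split.
  have [->|x'N] := pselect (coords x' xi = \bot); first exact: le0x.
  have Mx' : M (existT _ xi (coords x' xi)) by apply: x'M.
  apply: tub; split=> //; rewrite leNgt; apply/negP => /= xx'.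
  by apply: Q0; exists (coords x' xi).
(* Here a single value p of M with [a < p <= x xi] forces [a < x' xi]. *)
have lower a : a < trace M (coords x) xi -> G [set x' | a < coords x' xi].
  move=> az; have [p [Mp px] ap] : exists2 p,
      M (existT _ xi p) /\ p <= coords x xi & a < p.
    apply: contrapT => np; move: az; rewrite ltNge tlub// => p Bp.
    by rewrite leNgt; apply/negP => ap; apply: np; exists p.
  exists [set existT _ xi p] => [|x' [_ _ x'E] /=].
    by split => [|_ ->]; [exact: finite_set1|].
  apply: lt_le_trans ap _.
  have : ([set existT _ xi p] `&` below (coords x)) (existT _ xi p) by [].
  by rewrite -x'E => -[].
rewrite zxi; apply: cvg_order_rays => // b zb.
by apply: filterS upper => x' /= /le_lt_trans; apply.
Qed.

End SigmaProduct.

(** * Exponential separability *)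

Section ExponentialSeparability.
Context {I : Type} {d : I -> Order.disp_t}.
Variable gamma : forall xi : I, bOrderType (d xi).
Hypothesis gamma_ord : forall xi, is_ordinal (gamma xi).

Lemma coords_finite (x : sigma_product gamma) :
  finite_set (support_graph (coords x)).
Proof. by apply: support_graph_finite; exact: (set_valP x). Qed.

Lemma coords_inj : injective (@coords I d gamma).
Proof. exact: val_inj. Qed.

Lemma sigma_trace (M : set (coord_value gamma)) (x : sigma_product gamma) :
  exists z : sigma_product gamma, coords z = trace M (coords x).
Proof.
have zfin : sigma_set (trace M (coords x) : full_product gamma).
  by apply: sub_finite_set (set_valP x); exact: trace_support.
by exists (SigSub (mem_set zfin)).
Qed.

Lemma sigma_product_exponentially_separable :
  exponentially_separable (sigma_product gamma).
Proof.
move=> FF FFc FFcl.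
pose coords_img (F : set (sigma_product gamma)) := @coords _ _ gamma @` F.
have [||M Mc MP] := @reflecting_set _ _ gamma (coords_img @` FF).
- exact: (sub_countable (card_image_le _ _)).
- by move=> _ _ [F _ <-] [x _ <-]; exact: coords_finite.
have [r rP] := choice (sigma_trace M).
exists (range r); split.
  have [V Vc VP] := countable_trace_values gamma_ord Mc.
  have inj : {in range r &,
      injective (@support_graph _ _ gamma \o @coords _ _ gamma)}.
    by move=> x y _ _ /support_graph_inj /coords_inj.
  rewrite -(eq_countable (inj_card_eq inj)).
  apply: sub_countable (countable_finite_subset Vc); apply: subset_card_le.
  move=> _ [_ [x _ <-] <-] /=; rewrite rP; split; first exact: VP.
  by rewrite -rP; exact: coords_finite.
move=> G GFF [x xG]; exists (r x); split; first by exists x.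
move=> F GF; have FFF := GFF _ GF.
apply: (closed_trace gamma_ord (FFcl _ FFF) _ (rP x)) => S Sfin SM.
have [||//||_ [[x' Fx' <-] x'M x'E]] := MP (coords_img F) (coords x) S.
- by exists F.
- by exists x => //; exact: xG.
- by [].
- by exists x'.
Qed.

End ExponentialSeparability.

Theorem theorem14 (dl : Order.disp_t) (lambda : orderType dl)
    (lambda_card : is_cardinal lambda)
    (d : lambda -> Order.disp_t)
    (gamma : forall xi : lambda, bOrderType (d xi))
    (gamma_ord : forall xi : lambda, is_ordinal (gamma xi)) :
  exponentially_separable (sigma_product gamma).
Proof. exact: sigma_product_exponentially_separable. Qed.
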